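(* For every connected graph $\hat G$ on $n$ vertices with maximum degree $\Delta$, $$\mathrm{OPT}(\hat G)\le n^{1+O\left(\sqrt{(\log\log n+\log\Delta)/\log n}\right)},$$ where the constant in the $O(\cdot)$ is absolute.
   Context: Let $\hat G=(V,\hat E)$ be a connected unweighted graph with shortest-path metric $\hat\delta$. Let $\widehat{\mathit{NE}}$ be the set of unordered pairs $\{a,b\}$ of distinct vertices with $\{a,b\}\notin\hat E$. For $(u,v)\in V^2$, let $S_{u,v}$ be the set of $\{a,b\}\in\widehat{\mathit{NE}}$ such that $\hat\delta(u,a)+\hat\delta(b,v)+1<\hat\delta(u,v)$ or $\hat\delta(u,b)+\hat\delta(a,v)+1<\hat\delta(u,v)$. Define $\mathrm{OPT}(\hat G)$ as the minimum cardinality of a set $T\subseteq V\times V$ such that $\bigcup_{(u,v)\in T}S_{u,v}=\widehat{\mathit{NE}}$. (Equivalently, $\mathrm{OPT}(\hat G)$ is the minimum number of distance queries that certify, for an unknown graph $G\supseteq\hat G$ on $V$, that every non-edge of $\hat G$ is a non-edge of $G$.) *)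

(* Defs.v *)
From mathcomp Require Import all_boot.
From Stdlib Require Import Reals.
Set Implicit Arguments. Unset Strict Implicit. Unset Printing Implicit Defensive.

Definition simple_graph (T : finType) (e : rel T) : Prop :=
  symmetric e /\ irreflexive e.

Definition connected_graph (T : finType) (e : rel T) : Prop :=
  forall x y : T, connect e x y.

(* Shortest-path distance: least k such that there is an e-path of k edges
   from x to y (searched over k < #|T|; connected graphs always succeed). *)
Definition gdist (T : finType) (e : rel T) (x y : T) : nat :=
  find (fun k => [exists p : k.-tuple T, path e x p && (last x p == y)])
       (iota 0 #|T|).

Definition maxdeg (T : finType) (e : rel T) : nat :=
  \max_(x : T) #|[set y | e x y]|.

Definition inS (T : finType) (e : rel T) (u v a b : T) : bool :=
  (gdist e u a + gdist e b v + 1 < gdist e u v) ||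
  (gdist e u b + gdist e a v + 1 < gdist e u v).

(* T0 covers all non-edges of the graph (non-edges represented by
   ordered pairs (a,b), a != b, not adjacent; S is symmetric in a,b). *)
Definition covers (T : finType) (e : rel T) (T0 : {set T * T}) : bool :=
  [forall a : T, forall b : T, ((a != b) && ~~ e a b) ==>
     [exists uv in T0, inS e uv.1 uv.2 a b]].

Definition OPT (T : finType) (e : rel T) : nat :=
  find (fun k => [exists T0 : {set T * T}, (#|T0| == k) && covers e T0])
       (iota 0 (#|T| * #|T|).+1).

(* Main.v *)
Require Import Defs.
From mathcomp Require Import all_boot.
From Stdlib Require Import Reals.
From Stdlib Require Import ZArith Lra.
(* Reals rebinds [^] on nat to Nat.pow; importing ssrnat again restores expn. *)
From mathcomp Require Import ssrnat zify.

(** Recursive use of Thorup-Zwick centers.  Given a set U of vertices, choose a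
small set A of centers such that every cell {v in U : d(w,v) < d(A,v)} has at
most |U|/s elements, and query A x U.  A non-edge inside U that these queries do
not cover has both ends in one extended cell {b in U : d(x,b) <= d(A,b) + 2},
x in A; such a cell is contained in the union of the cells of the
O(Delta^3) vertices within distance 3 of x and of these vertices themselves.
Recursing on the extended cells for k levels with s = t (Delta+1)^3 and
t ~ n^(1/k) uses n^(1+1/k) (Delta log n)^O(k) queries, and
k ~ sqrt(log n / (log log n + log Delta)) balances the two factors. *)

(** * Counting and power inequalities *)

(** At most one of the two orders of a pair gives a strict inequality. *)
Lemma double_sum_ltn (I : finType) (P : {set I}) (f : I -> nat) :
  2 * (\sum_(x in P) \sum_(w in P) (f w < f x)) <= #|P| ^ 2.
Proof.
rewrite -mulnn -sum_nat_const mul2n -addnn [X in _ + X]exchange_big -big_split.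
apply: leq_sum => x _; rewrite -big_split -[leqRHS]sum1_card /=.
by apply: leq_sum => w _; case: (ltngtP (f w) (f x)).
Qed.

Lemma sum_sqr_ge (I : finType) (P : {set I}) (f : I -> nat) :
  (\sum_(i in P) f i) ^ 2 <= #|P| * \sum_(i in P) f i ^ 2.
Proof.
rewrite -(leq_pmul2l (isT : 0 < 2)) -mulnn big_distrlr /=.
have E : #|P| * \sum_(i in P) f i ^ 2 = \sum_(i in P) \sum_(j in P) f j ^ 2.
  by rewrite sum_nat_const.
rewrite [leqRHS]mul2n -addnn {2}E {1}E [X in _ <= X + _]exchange_big -big_split.
rewrite big_distrr /=; apply: leq_sum => i _.
rewrite -big_split big_distrr /=; apply: leq_sum => j _.
exact: nat_Cauchy.
Qed.

Lemma leq_expn2r m n p : m <= n -> m ^ p <= n ^ p.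
Proof. by case: p => // p le; rewrite leq_exp2r. Qed.

(** Bernoulli's inequality, giving (1 - 1/(m+1))^(m+1) <= 1/2 without division; with m+1 = 2s it
    says that 2s greedy rounds halve the potential. *)
Lemma double_expn_le m : 2 * m ^ m.+1 <= m.+1 ^ m.+1.
Proof.
have Bernoulli p : m ^ p.+1 + p.+1 * m ^ p <= m.+1 ^ p.+1.
  elim: p => [|p IH]; first by rewrite !expn1 expn0; lia.
  rewrite (expnS m.+1); apply: leq_trans (leq_mul (leqnn m.+1) IH).
  by rewrite !(expnS m); nia.
apply: leq_trans (Bernoulli m); rewrite !expnS; nia.
Qed.

Lemma find_iota_le (P : pred nat) n k : k < n -> P k -> find P (iota 0 n) <= k.
Proof.
move=> kn Pk; rewrite leqNgt; apply/negP => lt.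
by have := before_find 0 lt; rewrite nth_iota // add0n Pk.
Qed.

Lemma card_bigcup_le (T I : finType) (P : {set I}) (F : I -> {set T}) :
  #|\bigcup_(i in P) F i| <= \sum_(i in P) #|F i|.
Proof.
elim/big_rec2: _ => [|i m A _ IH]; first by rewrite cards0.
by apply: leq_trans (leq_card_setU _ _) _; rewrite leq_add2l.
Qed.

(** * Greedy choice of centers with small cells *)

Section Centers.

Variables (T : finType) (d : T -> T -> nat) (U : {set T}) (s : nat).

Definition cell (A : {set T}) (w : T) : {set T} :=
  [set v in U | [forall x in A, d w v < d x v]].

Definition large_cells (A : {set T}) : {set T} :=
  [set w | #|U| < #|cell A w| * s].

(** A large cell is nonempty, so this vanishes exactly when no large cell is left. *)
Definition potential (A : {set T}) : nat :=
  \sum_(w in large_cells A) #|cell A w|.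

Lemma in_cellU1 (A : {set T}) (x w v : T) :
  (v \in cell (x |: A) w) = (v \in cell A w) && (d w v < d x v).
Proof.
rewrite !inE; case: (v \in U) => //=; apply/forall_inP/andP.
  move=> H; split; last by apply: H; rewrite setU11.
  by apply/forall_inP => y yA; apply: H; rewrite setU1r.
by case=> /forall_inP H Hx y /setU1P[-> //|]; exact: H.
Qed.

Lemma cellU1_sub (A : {set T}) (x w : T) : cell (x |: A) w \subset cell A w.
Proof. by apply/subsetP => v; rewrite in_cellU1 => /andP[]. Qed.

(* Averaging over x drawn uniformly from the large cells W: for each v, if m of
   the w in W have v in their cell, a uniform x among those m removes v from at
   least half of them.  The total gain sum_v m_v^2 / (2|W|) is at least
   potential / (2s) by Cauchy-Schwarz. *)
Lemma potential_decrease (A : {set T}) : potential A > 0 ->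
  exists x, potential A + 2 * s * potential (x |: A) <= 2 * s * potential A.
Proof.
move=> p_gt0; set p := potential A; set W := large_cells A.
pose q x := \sum_(w in W) #|cell (x |: A) w|.
(* Cells only shrink when a center is added, so every new large cell is already indexed by [W]. *)
have pot_le_q x : potential (x |: A) <= q x.
  rewrite /potential /q big_mkcond [leqRHS]big_mkcond /=.
  apply: leq_sum => w _; case: ifP => // wx; suff -> : w \in W by [].
  move: wx; rewrite !inE => /leq_trans; apply.
  by rewrite leq_mul2r subset_leq_card ?orbT ?cellU1_sub.
pose Wv v := [set w in W | v \in cell A w].
have p_def : p = \sum_(v in U) #|Wv v|.
  rewrite /p /potential.
  transitivity (\sum_(w in W) \sum_(v in U) (v \in cell A w)).
    apply: eq_bigr => w _; rewrite -sum1_card big_mkcond [RHS]big_mkcond /=.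
    by apply: eq_bigr => v _; rewrite inE; case: (v \in U) => //=; case: ifP.
  rewrite exchange_big; apply: eq_bigr => v _.
  rewrite -sum1_card big_mkcond [RHS]big_mkcond /=.
  by apply: eq_bigr => w _; rewrite [in RHS]inE; case: (w \in W); case: (v \in _).
have sum_q : 2 * \sum_(x in W) q x + \sum_(v in U) #|Wv v| ^ 2 <= 2 * (#|W| * p).
  have -> : \sum_(x in W) q x = \sum_(v in U) \sum_(w in Wv v) \sum_(x in W) (d w v < d x v).
    transitivity (\sum_(x in W) \sum_(v in U) \sum_(w in Wv v) (d w v < d x v)).
      apply: eq_bigr => x _; rewrite /q.
      transitivity (\sum_(w in W) \sum_(v in U) (v \in cell (x |: A) w)).
        apply: eq_bigr => w _; rewrite -sum1_card big_mkcond [RHS]big_mkcond /=.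
        apply: eq_bigr => v _; rewrite in_cellU1 [v \in cell _ _]inE.
        by case: (v \in U) => //=; case: ifP.
      rewrite exchange_big; apply: eq_bigr => v _.
      rewrite big_mkcond [RHS]big_mkcond /=; apply: eq_bigr => w _.
      by rewrite in_cellU1 [w \in Wv v]inE; case: (w \in W); case: (v \in cell A w).
    by rewrite exchange_big; apply: eq_bigr => v _; rewrite exchange_big.
  rewrite p_def !big_distrr -big_split /=; apply: leq_sum => v _.
  have sub : Wv v \subset W by apply/subsetP => w; rewrite inE => /andP[].
  (* With m = [#|Wv v|], pairs inside [Wv v] contribute at most m^2/2 and the others at most
     m([#|W|] - m). *)
  have -> : \sum_(w in Wv v) \sum_(x in W) (d w v < d x v)
     = \sum_(w in Wv v) \sum_(x in Wv v) (d w v < d x v)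
       + \sum_(w in Wv v) \sum_(x in W :\: Wv v) (d w v < d x v).
    rewrite -big_split; apply: eq_bigr => w _ /=.
    by rewrite (big_setID (Wv v)) /= (setIidPr sub).
  have le1 : \sum_(w in Wv v) \sum_(x in W :\: Wv v) (d w v < d x v)
             <= #|Wv v| * (#|W| - #|Wv v|).
    rewrite -sum_nat_const; apply: leq_sum => w _.
    rewrite -(cardsDS sub) -sum1_card; apply: leq_sum => x _; exact: leq_b1.
  have le2 := double_sum_ltn _ (Wv v) (d^~ v).
  rewrite exchange_big /= in le2.
  have := subset_leq_card sub; move: le1 le2; rewrite -mulnn; nia.
have W_le : #|W| * #|U| <= s * p.
  rewrite -sum_nat_const /p /potential big_distrr /=; apply: leq_sum => w.
  by rewrite inE mulnC => /ltnW.
have U_gt0 : 0 < #|U|.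
  rewrite card_gt0; apply/negP => /eqP U0; move: p_gt0.
  by rewrite -/p p_def U0 big_set0.
have pW_le : p * #|W| <= s * \sum_(v in U) #|Wv v| ^ 2.
  have CS := sum_sqr_ge _ U (fun v => #|Wv v|); rewrite -p_def in CS.
  rewrite -(leq_pmul2r U_gt0) -mulnA.
  apply: leq_trans (leq_mul (leqnn p) W_le) _.
  by rewrite mulnCA mulnn -mulnA leq_mul // mulnC.
(* If every [x] in [W] failed, summing the failures over [W] would contradict [sum_q] and
   [pW_le]. *)
case: (boolP [exists x in W, p + 2 * s * q x <= 2 * s * p]) => [/exists_inP[x _ Hx]|].
  by exists x; apply: leq_trans Hx; rewrite leq_add2l leq_mul2l pot_le_q orbT.
rewrite negb_exists_in => /forall_inP Hq.
have [w0 w0W] : exists w, w \in W.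
  apply/existsP; rewrite -[X in is_true X]negbK negb_exists; apply/negP => /forallP H.
  by move: p_gt0; rewrite /potential big1 // => w wW; rewrite (negbTE (H w)) in wW.
have : \sum_(x in W) (2 * s * p) < \sum_(x in W) (p + 2 * s * q x).
  rewrite (bigD1 w0) //= [ltnRHS](bigD1 w0) //= -addSn leq_add //.
    by rewrite ltnNge Hq.
  by apply: leq_sum => x /andP[xW _]; apply: ltnW; rewrite ltnNge Hq.
rewrite big_split /= !sum_nat_const -big_distrr /=.
move: sum_q pW_le; set a := \sum_(x in W) q x; set b := \sum_(v in U) _.
by nia.
Qed.

(** Each round shrinks the potential by a factor 1 - 1/(2s), from at most [#|T| ^ 2] for the empty
    set. *)
Lemma greedy_centers (r : nat) : 0 < s ->
  exists2 A : {set T}, #|A| <= r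
    & (2 * s) ^ r * potential A <= (2 * s).-1 ^ r * #|T| ^ 2.
Proof.
move=> s_gt0; elim: r => [|r [A Ar IH]].
  exists set0; rewrite ?cards0 // !mul1n.
  apply: (@leq_trans (\sum_(w in T) #|T|)); last by rewrite sum_nat_const.
  rewrite /potential big_mkcond /=; apply: leq_sum => w _.
  by case: ifP => // _; exact: max_card.
case: (posnP (potential A)) => [p0|/potential_decrease[x Hx]].
  by exists A; [exact: leqW | rewrite p0 muln0].
exists (x |: A); first by rewrite cardsU1; case: (x \in A); lia.
rewrite expnSr -mulnA.
apply: (@leq_trans ((2 * s) ^ r * ((2 * s).-1 * potential A))).
  by rewrite leq_mul2l; apply/orP; right; nia.
by rewrite mulnCA expnS -mulnA leq_mul2l IH orbT.
Qed.

(** The 4sl rounds form 2l blocks of 2s rounds, each halving the potential; it drops below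
    [#|T| ^ 2] / 2^(2l) < 1, hence to 0. *)
Lemma centers_exist (l : nat) : 0 < s -> #|T| < 2 ^ l ->
  exists2 A : {set T}, #|A| <= 4 * s * l & forall w, #|cell A w| * s <= #|U|.
Proof.
move=> s_gt0 ltTl; have [A leA leP] := greedy_centers (2 * s * (2 * l)) s_gt0.
exists A; first by apply: leq_trans leA _; lia.
suff p0 : potential A = 0.
  move=> w; rewrite leqNgt; apply/negP => wl.
  have wW : w \in large_cells A by rewrite inE.
  by move: p0 wl; rewrite /potential (bigD1 w) //=; case: #|cell A w|.
apply/eqP; rewrite eqn0Ngt; apply/negP => p_gt0.
have [m Em] : exists m, 2 * s = m.+1 by exists (2 * s).-1; lia.
move: leP; rewrite Em /= ![_ ^ (m.+1 * _)]expnM leqNgt => /negP; apply.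
have m_gt0 : 0 < m by lia.
have e_gt0 : 0 < (m ^ m.+1) ^ (2 * l) by rewrite !expn_gt0 m_gt0.
have lt1 : #|T| ^ 2 < 2 ^ (2 * l) by rewrite mulnC expnM ltn_sqr.
apply: (@leq_trans (2 ^ (2 * l) * (m ^ m.+1) ^ (2 * l))).
  by rewrite [ltnRHS]mulnC ltn_pmul2l.
rewrite -expnMn; apply: leq_trans (leq_pmulr _ p_gt0).
exact: leq_expn2r (double_expn_le m).
Qed.

End Centers.

(** * Shortest paths and balls *)

Section Distance.

Variables (T : finType) (e : rel T).

Lemma gdist_le_size x p : path e x p -> size p < #|T| ->
  gdist e x (last x p) <= size p.
Proof.
move=> ep sp; apply: find_iota_le => //.
by apply/existsP; exists (in_tuple p); rewrite ep eqxx.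
Qed.

Lemma gdistxx x : gdist e x x = 0.
Proof.
apply/eqP; rewrite -leqn0; apply: (@gdist_le_size x [::]) => //.
by apply/card_gt0P; exists x.
Qed.

Definition closed_nbhd (X : {set T}) : {set T} :=
  \bigcup_(x in X) (x |: [set y | e x y]).

Lemma card_closed_nbhd X : #|closed_nbhd X| <= (maxdeg e).+1 * #|X|.
Proof.
apply: leq_trans (card_bigcup_le _ _ _ _) _.
rewrite mulnC -sum_nat_const; apply: leq_sum => x _.
rewrite cardsU1 -addn1 addnC; apply: leq_add; last exact: leq_b1.
exact: (leq_bigmax x).
Qed.

Lemma card_iter_closed_nbhd j x : #|iter j closed_nbhd [set x]| <= (maxdeg e).+1 ^ j.
Proof.
elim: j => [|j IH]; first by rewrite cards1.
apply: leq_trans (card_closed_nbhd _) _.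
by rewrite expnS leq_mul2l IH orbT.
Qed.

Hypothesis conn : connected_graph e.

(** A path without repeated vertices has fewer than [#|T|] edges, so the bounded search in [gdist]
    succeeds. *)
Lemma gdist_path x y :
  exists p, [/\ path e x p, last x p = y & size p = gdist e x y].
Proof.
set P := fun k => [exists p : k.-tuple T, path e x p && (last x p == y)].
have hasP : has P (iota 0 #|T|).
  have /connectP[p ep Ey] := conn x y; move: Ey.
  case: (shortenP ep) => q eq uq _ Ey; apply/hasP; exists (size q).
    by rewrite mem_iota -[_ < _]/(size (x :: q) <= #|T|) -(card_uniqP uq) max_card.
  by apply/existsP; exists (in_tuple q); rewrite eq Ey eqxx.
have := nth_find 0 hasP; have := hasP; rewrite has_find size_iota => lt.
rewrite nth_iota // add0n => /existsP[p /andP[ep /eqP lp]].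
by exists p; rewrite size_tuple.
Qed.

Lemma gdist_step x y : x != y -> exists2 z, e x z & gdist e z y < gdist e x y.
Proof.
move=> xy; have [[|z p] [/= ep lp <-]] := gdist_path x y.
  by rewrite lp eqxx in xy.
case/andP: ep => exz ep; exists z => //; rewrite -lp ltnS.
(* For a long tail, [gdist] is still at most its default value [#|T|]. *)
case: (ltnP (size p) #|T|) => [|le]; first exact: gdist_le_size.
apply: leq_trans le; apply: leq_trans (find_size _ _) _.
by rewrite size_iota.
Qed.

(** Walk [j] steps along a shortest path, stopping early if [y] is reached. *)
Lemma gdist_iter_nbhd j x y : exists2 w, w \in iter j closed_nbhd [set x]
  & (w == y) || (gdist e w y + j <= gdist e x y).
Proof.
elim: j => [|j [w wr Hw]]; first by exists x; rewrite ?inE // addn0 leqnn orbT.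
have [wy|wy] := eqVneq w y.
  exists w; last by rewrite wy eqxx.
  by apply/bigcupP; exists w => //; rewrite setU11.
have [z ewz lt] := gdist_step w y wy; exists z.
  by apply/bigcupP; exists w => //; rewrite !inE ewz orbT.
by move: Hw; rewrite (negbTE wy) /=; lia.
Qed.

Lemma gdist_nonedge a b : a != b -> ~~ e a b -> 1 < gdist e a b.
Proof.
move=> ab neab; have [[|z [|z' p]] [/= ep lp <-]] := gdist_path a b => //.
  by rewrite lp eqxx in ab.
by move: ep; rewrite andbT lp (negbTE neab).
Qed.

End Distance.

(** * Recursive covering of non-edges *)

Section Cover.

Variables (T : finType) (e : rel T).
Hypothesis conn : connected_graph e.

(** The slack 2 is 1 + 1: passing from [a] to [b] across an uncovered non-edge can raise the
    distance to one center by 1 and lower that to another by 1. *)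
Definition extended_cell (A U : {set T}) (x : T) : {set T} :=
  [set b in U | [forall y in A, gdist e x b <= gdist e y b + 2]].

(* The vertex w three steps along a shortest path from x to a point b of the
   extended cell satisfies d(w,b) < d(A,b), i.e. b lies in the plain cell of w. *)
Lemma card_extended_cell (A U : {set T}) (m : nat) x :
  (forall w, #|cell T (gdist e) U A w| <= m) ->
  #|extended_cell A U x| <= (maxdeg e).+1 ^ 3 * m.+1.
Proof.
move=> cell_le; set R := iter 3 (closed_nbhd T e) [set x].
have sub : extended_cell A U x
           \subset \bigcup_(w in R) (w |: cell T (gdist e) U A w).
  apply/subsetP => b; rewrite inE => /andP[bU /forall_inP bx].
  have [w wR Hw] := gdist_iter_nbhd T e conn 3 x b.
  (* A walk that stops early gives [w] = [b]; adding [w] to its own cell accounts for this and for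
     the [m.+1]. *)
  apply/bigcupP; exists w => //; case/orP: Hw => [/eqP-> |le]; first exact: setU11.
  apply/setU1r; rewrite inE bU; apply/forall_inP => y yA.
  by have := bx y yA; lia.
apply: leq_trans (subset_leq_card sub) _.
apply: leq_trans (card_bigcup_le _ _ _ _) _.
apply: (@leq_trans (#|R| * m.+1)); last by rewrite leq_mul2r card_iter_closed_nbhd orbT.
rewrite -sum_nat_const; apply: leq_sum => w _.
by rewrite cardsU1 -add1n leq_add ?leq_b1.
Qed.

(** Queries may leave [U], and distances are those of the whole graph, since centers are drawn from
    all of [T]. *)
Definition covers_in (U : {set T}) (Q : {set T * T}) : Prop :=
  forall a b, a \in U -> b \in U -> a != b -> ~~ e a b ->
    exists2 uv, uv \in Q & inS e uv.1 uv.2 a b.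

Lemma covers_in_setX U : covers_in U (setX U U).
Proof.
move=> a b aU bU ab neab; exists (a, b); first by rewrite in_setX aU.
by rewrite /inS /= !gdistxx gdist_nonedge.
Qed.

(* If no query (x, a) or (x, b) with x in A separates a and b, their distances
   to every center differ by at most 1, so both lie in the extended cell of the
   center nearest to a. *)
Lemma covers_in_split (A U : {set T}) (F : T -> {set T * T}) : A != set0 ->
  (forall x, x \in A -> covers_in (extended_cell A U x) (F x)) ->
  covers_in U (setX A U :|: \bigcup_(x in A) F x).
Proof.
move=> /set0Pn[x0 x0A] HF a b aU bU ab neab.
case: (boolP [exists x in A, (gdist e x a + 1 < gdist e x b)
                             || (gdist e x b + 1 < gdist e x a)]).
  case/exists_inP => x xA /orP[lt|lt].
    exists (x, b); first by rewrite !inE /= xA bU.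
    by rewrite /inS /= gdistxx addn0 lt.
  exists (x, a); first by rewrite !inE /= xA aU.
  by rewrite /inS /= gdistxx addn0 lt orbT.
rewrite negb_exists_in => /forall_inP near.
have [x xA xmin] : exists2 x, x \in A & forall y, y \in A -> gdist e x a <= gdist e y a.
  by case: (arg_minnP (fun y => gdist e y a) x0A) => x xA xmin; exists x.
have [||uv uvF ?] := HF x xA a b _ _ ab neab.
- by rewrite inE aU; apply/forall_inP => y yA; have := xmin y yA; lia.
- rewrite inE bU; apply/forall_inP => y yA.
  by have := xmin y yA; have := near x xA; have := near y yA; lia.
- by exists uv => //; rewrite inE; apply/orP; right; apply/bigcupP; exists x.
Qed.

(** The term [2 * B] survives recursion: an extended cell has at most B(|U|/(Bt) + 1) = |U|/t + B
    elements, and 2B/t + B <= 2B as t >= 2. The power's base bounds the number of centers, and the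
    factor [k.+1] counts levels of equal cost bound. *)
Lemma recursive_cover (t l k : nat) (U : {set T}) :
  let B := (maxdeg e).+1 ^ 3 in
  1 < t -> #|T| < 2 ^ l -> 0 < l -> #|U| <= t ^ k + 2 * B ->
  exists2 Q : {set T * T}, #|Q| <= 9 * B ^ 2 * t * k.+1 * (4 * (B * t) * l) ^ k
           & covers_in U Q.
Proof.
move=> B t1 ltTl l0; have B0 : 0 < B by rewrite expn_gt0.
elim: k U => [|k IH] U leU.
  exists (setX U U); last exact: covers_in_setX.
  rewrite cardsX expn0 !muln1 -mulnn; rewrite expn0 in leU.
  apply: leq_trans (leq_mul leU leU) _.
  by nia.
set K := 4 * (B * t) * l.
have [U0|U0] := posnP #|U|.
  exists set0; first by rewrite cards0.
  by move=> a b; rewrite (cards0_eq U0) inE.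
have s0 : 0 < B * t by rewrite muln_gt0 B0 ltnW.
have [A leA cellA] := centers_exist T (gdist e) U (B * t) l s0 ltTl.
(* Without centers every cell would be all of [U], too large since Bt > 1. *)
have A0 : A != set0.
  apply/eqP => A0; have /card_gt0P[w _] := U0; have := cellA w.
  have -> : cell T (gdist e) U A w = U.
    by apply/setP => v; rewrite inE A0; case: (v \in U) => //=; apply/forall_inP => y; rewrite inE.
  by nia.
have lecell x : #|extended_cell A U x| <= t ^ k + 2 * B.
  apply: leq_trans (@card_extended_cell A U (#|U| %/ (B * t)) x _) _.
    by move=> w; rewrite leq_divRL.
  rewrite -/B mulnS.
  have := leq_divM #|U| (B * t); set D := #|U| %/ _ => HD.
  have : B * D * t <= t ^ k * t + 2 * B.
    by rewrite -expnSr; apply: leq_trans leU; move: HD; nia.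
  by move: (t ^ k) => z; nia.
have [F leF covF] := fin_all_exists2 (fun x => IH _ (lecell x)).
exists (setX A U :|: \bigcup_(x in A) F x); last by apply: covers_in_split.
apply: leq_trans (leq_card_setU _ _) _; rewrite cardsX.
have leS : #|\bigcup_(x in A) F x| <= #|A| * (9 * B ^ 2 * t * k.+1 * K ^ k).
  apply: leq_trans (card_bigcup_le _ _ _ _) _.
  by rewrite -sum_nat_const; apply: leq_sum => x _; exact: leF.
have le1 : #|A| * #|U| <= K * (t ^ k.+1 + 2 * B) by apply: leq_mul.
have le2 : #|A| * (9 * B ^ 2 * t * k.+1 * K ^ k) <= K * (9 * B ^ 2 * t * k.+1 * K ^ k).
  by rewrite leq_mul2r leA orbT.
apply: leq_trans (leq_add le1 (leq_trans leS le2)) _.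
have tK : t ^ k <= K ^ k by apply: leq_expn2r; rewrite /K; nia.
have : t ^ k.+1 + 2 * B <= 9 * B ^ 2 * t * K ^ k.
  rewrite expnS -mulnn; have tk0 : 0 < t ^ k by rewrite expn_gt0 ltnW.
  have : t * t ^ k <= t * K ^ k by rewrite leq_mul2l tK orbT.
  have : t <= t * K ^ k by apply: leq_pmulr; apply: leq_trans tK.
  rewrite -[_ * t * _]mulnA; move: (t * K ^ k) (t * t ^ k) => y z ty zy.
  have By : B <= B * y by apply: leq_pmulr; lia.
  have yB : y <= B * y by apply: leq_pmull.
  have BBy : B * y <= B * B * y by rewrite -mulnA leq_pmull.
  by rewrite -[9 * _ * _]mulnA; lia.
move: (t ^ k.+1 + 2 * B) (9 * B ^ 2 * t) => x z le.
rewrite [K ^ k.+1]expnS [leqRHS]mulnCA -mulnDr leq_mul2l.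
by rewrite [z * k.+2]mulnS mulnDl leq_add2r le orbT.
Qed.

Lemma OPT_le_card (Q : {set T * T}) : covers_in [set: T] Q -> OPT e <= #|Q|.
Proof.
move=> cov; apply: find_iota_le.
  by rewrite ltnS -card_prod max_card.
apply/existsP; exists Q; rewrite eqxx /=.
apply/forallP => a; apply/forallP => b; apply/implyP => /andP[ab neab].
by apply/exists_inP; apply: cov; rewrite ?inE.
Qed.

Lemma OPT_le (t k : nat) :
  let B := (maxdeg e).+1 ^ 3 in
  1 < t -> #|T| <= t ^ k ->
  OPT e <= 9 * B ^ 2 * t * k.+1 * (4 * (B * t) * (trunc_log 2 #|T|).+1) ^ k.
Proof.
move=> B t1 le; have [|||Q leQ cov] := @recursive_cover t (trunc_log 2 #|T|).+1 k setT t1.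
- exact: trunc_log_ltn.
- by [].
- by rewrite cardsT; apply: leq_trans le _; exact: leq_addr.
by apply: leq_trans leQ; exact: OPT_le_card.
Qed.

End Cover.

(** * Exponential bounds over the reals *)

Section RealEstimates.

Local Open Scope R_scope.

Lemma nat_above r : 0 <= r -> exists n : nat, r < INR n <= r + 1.
Proof.
move=> r0; have [gt le] := archimed r; exists (Z.to_nat (up r)).
rewrite INR_IZR_INZ Z2Nat.id; first by lra.
by apply: le_IZR; lra.
Qed.

Lemma INR_leq m n : (m <= n)%N -> INR m <= INR n.
Proof. by move=> le; apply: le_INR; apply/leP. Qed.

Lemma INR_muln m n : INR (m * n)%N = INR m * INR n.
Proof. exact: mult_INR. Qed.

Lemma INR_expn m p : INR (m ^ p)%N = INR m ^ p.
Proof. by elim: p => // p IH; rewrite expnS INR_muln IH. Qed.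

Lemma exp_pow a p : exp a ^ p = exp (INR p * a).
Proof.
elim: p => [|p IH]; first by rewrite Rmult_0_l exp_0.
by rewrite S_INR /= IH -exp_plus; congr exp; lra.
Qed.

Lemma exp_le a b : a <= b -> exp a <= exp b.
Proof. by case=> [lt|->]; [left; exact: exp_increasing | right]. Qed.

Lemma ln_monotone a b : 0 < a -> a <= b -> ln a <= ln b.
Proof. by move=> a0 [lt|->]; [left; exact: ln_increasing | right]. Qed.

Lemma Rmult_le_exp x y a b c : 0 <= x -> 0 <= y ->
  x <= exp a -> y <= exp b -> a + b <= c -> x * y <= exp c.
Proof.
move=> x0 y0 xa yb ab; apply: Rle_trans (exp_le _ _ ab).
by rewrite exp_plus; exact: Rmult_le_compat.
Qed.

Lemma pow_le_exp x a p c :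
  0 <= x -> x <= exp a -> INR p * a <= c -> x ^ p <= exp c.
Proof.
move=> x0 xa pa; apply: Rle_trans (exp_le _ _ pa).
by rewrite -exp_pow; apply: pow_incr.
Qed.

Lemma exp1_ge2 : 2 <= exp 1.
Proof. by have := exp_ineq1_le 1; lra. Qed.

Lemma pow2_le_exp p c : INR p <= c -> 2 ^ p <= exp c.
Proof. by move=> pc; apply: (pow_le_exp _ 1); have := exp1_ge2; lra. Qed.

Lemma ln_le_id x : 0 < x -> ln x <= x.
Proof. by move=> x0; have := exp_ineq1_le (ln x); rewrite exp_ln //; lra. Qed.

Lemma trunc_log2_le n : (0 < n)%N -> INR (trunc_log 2 n) <= 2 * ln (INR n).
Proof.
move=> n0; have := @trunc_logP 2 n isT n0; set m := trunc_log 2 n.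
move/INR_leq; rewrite INR_expn => le.
have p0 : 0 < INR 2 ^ m by apply: pow_lt; rewrite /=; lra.
have : ln (INR 2 ^ m) <= ln (INR n) by exact: ln_monotone.
rewrite ln_pow; last by rewrite /=; lra.
have -> : INR 2 = 2 by rewrite /=; lra.
by have := ln_lt_2; have := pos_INR m; nra.
Qed.

(* With k about L / Q = sqrt(L / z) and t about exp Q, the exponents k * z and
   L / k are both O(Q), and t ^ k = exp(L + O(Q)). *)
Lemma cover_count_le (n D t k : nat) (L z Q : R) :
  let B := (D.+1 ^ 3)%N in
  L = ln (INR n) -> z = ln L + ln (INR D) -> 0 < Q -> Q * Q = L * z ->
  (0 < n)%N -> (0 < D)%N -> 1 <= ln L -> 2 <= L -> 1 <= z <= 2 * Q ->
  INR k * Q <= L + Q -> exp Q < INR t <= exp Q + 1 ->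
  INR (9 * B ^ 2 * t * k.+1 * (4 * (B * t) * (trunc_log 2 n).+1) ^ k)%N
    <= exp (L + 75 * Q).
Proof.
move=> B EL Ez Q0 EQ n0 D0 lnL1 L2 [z1 zQ] kQ [_ tQ].
have P m : 0 <= INR m by exact: pos_INR.
have D1 : 1 <= INR D by have := INR_leq _ _ D0; rewrite /=; lra.
have lnD0 : 0 <= ln (INR D) by rewrite -ln_1; apply: ln_monotone; lra.
(* k z Q <= (L + Q) z = Q^2 + Q z <= 3 Q^2. *)
have kz : INR k * z <= 3 * Q.
  have : INR k * z * Q <= 3 * Q * Q by nra.
  by move/Rmult_le_reg_r; apply.
(* Since [ln L] and [ln D] are at most [z] and [z] >= 1, every factor depending on [D], [L] or a
   constant is at most exp of a multiple of [z]. *)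
have D_le : INR D.+1 <= exp (2 * z).
  apply: (Rle_trans _ (2 * INR D)); first by rewrite S_INR; lra.
  apply: (Rmult_le_exp _ _ 1 (ln (INR D))); try lra.
    exact: exp1_ge2.
  by rewrite exp_ln; lra.
have B_le : INR B <= exp (6 * z).
  by rewrite INR_expn; apply: (pow_le_exp _ (2 * z)) => //; rewrite /=; lra.
have t_le : INR t <= exp (z + Q).
  have := exp_ineq1_le Q => ge; apply: (Rle_trans _ (2 * exp Q)); first by lra.
  by apply: (Rmult_le_exp _ _ 1 Q); have := exp1_ge2; lra.
have l_le : INR (trunc_log 2 n).+1 <= exp (3 * z).
  have := trunc_log2_le n n0; rewrite -EL S_INR => le.
  apply: (Rle_trans _ (2 ^ 2 * L)); first by lra.
  apply: (Rmult_le_exp _ _ 2 (ln L)); try lra.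
    by apply: pow2_le_exp; rewrite /=; lra.
  by rewrite exp_ln; lra.
have c4 : INR 4 <= exp (2 * z).
  by have := pow2_le_exp 2 (2 * z); rewrite /=; lra.
have c9 : INR 9 <= exp (4 * z).
  by have := pow2_le_exp 4 (4 * z); rewrite /=; lra.
have k_le : INR k.+1 <= exp (INR k * z).
  apply: Rle_trans (exp_le (INR k) _ _); last by have := P k; nra.
  by rewrite S_INR; have := exp_ineq1_le (INR k); lra.
rewrite 2!INR_muln.
have -> : INR (9 * B ^ 2 * t)%N = INR (9 * B ^ 2)%N * INR t by rewrite INR_muln.
have pre_le : INR (9 * B ^ 2)%N <= exp (16 * z).
  rewrite INR_muln; apply: (Rmult_le_exp _ _ (4 * z) (12 * z)) => //; last by lra.
  by rewrite INR_expn; apply: (pow_le_exp _ (6 * z)) => //; rewrite /=; lra.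
have base_le : INR (4 * (B * t) * (trunc_log 2 n).+1)%N <= exp (12 * z + Q).
  rewrite INR_muln.
  apply: (Rmult_le_exp _ _ (9 * z + Q) (3 * z)) => //; last by lra.
  rewrite INR_muln.
  apply: (Rmult_le_exp _ _ (2 * z) (7 * z + Q)) => //; last by lra.
  rewrite INR_muln.
  by apply: (Rmult_le_exp _ _ (6 * z) (z + Q)) => //; lra.
(* The exponents add up to 17z + Q + 13kz + kQ <= 34Q + Q + 39Q + (L + Q), whence 75. *)
apply: (Rmult_le_exp _ _ (17 * z + Q + INR k * z) (INR k * (12 * z + Q))) => //.
- by do ![apply: Rmult_le_pos => //].
- apply: (Rmult_le_exp _ _ (17 * z + Q) (INR k * z)) => //; last by lra.
    exact: Rmult_le_pos.
  by apply: (Rmult_le_exp _ _ (16 * z) (z + Q)) => //; lra.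
- by rewrite INR_expn; apply: (pow_le_exp _ (12 * z + Q)) => //; lra.
- by lra.
Qed.

End RealEstimates.

(** * Choice of parameters and the final bound *)

Lemma maxdeg_gt0 (T : finType) (e : rel T) :
  connected_graph e -> 1 < #|T| -> 0 < maxdeg e.
Proof.
move=> conn /card_gt1P[x [y [_ _ xy]]].
have [z exz _] := gdist_step T e conn x y xy.
apply: leq_trans (leq_bigmax x); apply/card_gt0P; exists z.
by rewrite inE.
Qed.

Lemma maxdeg_le_card (T : finType) (e : rel T) : maxdeg e <= #|T|.
Proof. by apply/bigmax_leqP => x _; exact: max_card. Qed.

Theorem theorem6 :
  exists (C : R) (N0 : nat),
    forall (T : finType) (e : rel T),
      simple_graph e -> connected_graph e -> (N0 <= #|T|)%N ->
      (INR (OPT e) <=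
         Rpower (INR #|T|)
           (1 + C * sqrt ((ln (ln (INR #|T|)) + ln (INR (maxdeg e)))
                          / ln (INR #|T|))))%R.
Proof.
(* Beyond e^e one has ln ln n >= 1, which yields [z] >= 1. *)
have [N0 [N0_gt _]] := nat_above (exp (exp 1)) (Rlt_le _ _ (exp_pos _)).
exists 75%R, N0 => T e _ conn leN; set n := #|T|; set D := maxdeg e.
have e2 := exp1_ge2; have ee := exp_ineq1_le (exp 1).
have n_gt : (exp (exp 1) < INR n)%R by apply: Rlt_le_trans N0_gt (INR_leq _ _ leN).
have n1 : 1 < n by apply/ltP/INR_lt; rewrite /=; lra.
set L := ln (INR n); set z := (ln L + ln (INR D))%R.
have L_ge : (exp 1 <= L)%R.
  by rewrite -[exp 1]ln_exp; apply: ln_monotone; [exact: exp_pos | lra].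
have lnL1 : (1 <= ln L)%R by rewrite -[1%R]ln_exp; apply: ln_monotone; lra.
have D0 : 0 < D by exact: maxdeg_gt0.
have D1 : (1 <= INR D)%R by have := INR_leq _ _ D0.
have lnD0 : (0 <= ln (INR D))%R by rewrite -ln_1; apply: ln_monotone; lra.
have lnDL : (ln (INR D) <= L)%R.
  by apply: ln_monotone; [lra | exact: INR_leq (maxdeg_le_card _ _)].
have lnLL := ln_le_id L ltac:(lra).
have z1 : (1 <= z <= 2 * L)%R by rewrite /z; lra.
(* Then [Q / L] = sqrt(z/L), so the target is exp(L + 75Q). *)
pose Q := sqrt (L * z).
have EQ : (Q * Q = L * z)%R by apply: sqrt_sqrt; nra.
have Q0 : (0 < Q)%R by apply: sqrt_lt_R0; nra.
have zQ : (z <= 2 * Q)%R by nra.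
have [k [k_gt k_le]] := nat_above (L / Q) ltac:(apply: Rlt_le; apply: Rdiv_lt_0_compat; lra).
have [t tQ] := nat_above (exp Q) (Rlt_le _ _ (exp_pos _)).
have LQ : (L / Q * Q = L)%R by field; lra.
have kQ : (L <= INR k * Q <= L + Q)%R by nra.
have t1 : 1 < t.
  by apply/ltP/INR_lt; have := exp_ineq1_le Q; rewrite [INR 1]/=; lra.
(* t^k >= exp(kQ) >= exp(L) = n, both parameters having been rounded up. *)
have le_tk : n <= t ^ k.
  apply/leP/INR_le; rewrite INR_expn -[INR n]exp_ln; last by lra.
  apply: Rle_trans (exp_le _ _ (proj1 kQ)) _; rewrite -exp_pow.
  by apply: pow_incr; have := exp_pos Q; lra.
have le := INR_leq _ _ (OPT_le T e conn t k t1 le_tk).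
apply: Rle_trans le _.
have -> : sqrt (z / L) = (Q / L)%R.
  apply: sqrt_lem_1; first by apply: Rlt_le; apply: Rdiv_lt_0_compat; lra.
    by apply: Rlt_le; apply: Rdiv_lt_0_compat; lra.
  have -> : (Q / L * (Q / L) = Q * Q / L / L)%R by field; lra.
  by rewrite EQ; field; lra.
rewrite /Rpower -/L.
have -> : ((1 + 75 * (Q / L)) * L = L + 75 * Q)%R by field; lra.
by apply: (cover_count_le n D t k L z Q) => //; lra || exact: ltnW.
Qed.
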